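(* For every $n \geq 1$, the standard $n$-bit binary reflected Gray code $w_0, w_1, \ldots, w_{2^n-1}$ can be realized as successive states of a pair of stacks. That is, there exists a sequence $(S_0,T_0), (S_1,T_1), \ldots, (S_{2^n-1},T_{2^n-1})$ of pairs of stacks with entries in $\{0,1,\ldots,n-1\}$ such that: (i) for each $i$ with $0 \le i \le 2^n-1$, the entries of $S_i$ and $T_i$ taken together are exactly the bit positions at which $w_i$ has a $1$, each such position occurring exactly once in total (in exactly one of the two stacks); and (ii) for each $i$ with $0 \le i < 2^n-1$, the pair $(S_{i+1},T_{i+1})$ is obtained from $(S_i,T_i)$ by a single push or a single pop on exactly one of the two stacks, the other stack being unchanged.
   Context: Bit positions of an $n$-bit word are numbered $0,1,\ldots,n-1$ from the right. The standard binary reflected Gray code is defined recursively: the 1-bit code is the list $0, 1$; the $(k+1)$-bit code consists of the $2^k$ words of the $k$-bit code in order, each with a $0$ in bit position $k$ (prepended on the left), followed by the $2^k$ words of the $k$-bit code in reverse order, each with a $1$ in bit position $k$. A stack is a finite sequence of entries; a push appends one new entry at the top (end) of the sequence, and a pop removes the entry at the top (end) of a nonempty sequence. *)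

(* Defs.v *)
From mathcomp Require Import all_boot.

Set Implicit Arguments.
Unset Strict Implicit.
Unset Printing Implicit Defensive.

(* An n-bit word is the tuple of its bits as written, leftmost bit first;
   bit positions are numbered from the right. *)
Definition word (n : nat) := n.-tuple bool.

Definition bit (n : nat) (w : word n) (p : 'I_n) : bool := tnth w (rev_ord p).

(* The recursion is started one step early, from the empty word; [gray1]
   below checks that the 1-bit code is the list 0, 1. *)
Fixpoint gray (n : nat) : seq (word n) :=
  if n is k.+1 then
    [seq cons_tuple false w | w <- gray k]
      ++ [seq cons_tuple true w | w <- rev (gray k)]
  else [:: [tuple]].

Definition gray_word (n i : nat) : word n :=
  nth [tuple of nseq n false] (gray n) i.

Lemma gray1 : gray 1 = [:: [tuple false]; [tuple true]].
Proof. by congr [:: _; _]; apply: val_inj. Qed.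

Lemma size_gray n : size (gray n) = 2 ^ n.
Proof.
elim: n => //= n IHn.
by rewrite size_cat !size_map size_rev IHn expnS mul2n addnn.
Qed.

Lemma bit_cons_last n b (w : word n) : bit (cons_tuple b w) ord_max = b.
Proof. by rewrite /bit (tnth_nth false) /= subnn. Qed.

Lemma bit_cons_lower n b (w : word n) (p : 'I_n) :
  bit (cons_tuple b w) (widen_ord (leqnSn n) p) = bit w p.
Proof.
by rewrite /bit !(tnth_nth false) /= subSS -(subnSK (ltn_ord p)).
Qed.

(* The top of a stack is the end of the sequence. *)
Definition push (T : Type) (s s' : seq T) : Prop := exists x, s' = rcons s x.

Definition pop (T : Type) (s s' : seq T) : Prop := exists x, s = rcons s' x.

Definition stack_step (T : Type) (s s' : seq T) : Prop := push s s' \/ pop s s'.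

Definition pair_step (T : Type) (st st' : seq T * seq T) : Prop :=
  (stack_step st.1 st'.1 /\ st'.2 = st.2) \/
  (st'.1 = st.1 /\ stack_step st.2 st'.2).

Definition represents (n : nat) (st : seq 'I_n * seq 'I_n) (w : word n) : Prop :=
  uniq (st.1 ++ st.2) /\ forall p : 'I_n, (p \in st.1 ++ st.2) = bit w p.

(* Main.v *)
Require Import Defs.
From mathcomp Require Import all_boot.

(** Split the positions by parity and keep each stack sorted, smallest position
    on top.  When the Gray code flips position [p], all positions below [p - 1]
    are [0]; hence no position below [p] of the same parity as [p] is present,
    and the flip of [p] is a push or a pop on the stack of its parity. *)

Definition flips_at (n : nat) (p : 'I_n) (w w' : word n) : bool :=
  [forall q, bit w' q == bit w q (+) (q == p)]
    && [forall q : 'I_n, (q.+1 < p) ==> ~~ bit w q].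

Definition gray_adjacent (n : nat) (w w' : word n) : bool :=
  [exists p, flips_at n p w w'].

Lemma ord_split n (q : 'I_n.+1) :
  q = ord_max \/ exists p : 'I_n, q = widen_ord (leqnSn n) p.
Proof.
have [q_lt|n_le] := ltnP q n; [right | left].
  by exists (Ordinal q_lt); apply: val_inj.
by apply: val_inj; apply/eqP; rewrite eqn_leq n_le -ltnS ltn_ord.
Qed.

Lemma bit_nseq_false n (p : 'I_n) : bit [tuple of nseq n false] p = false.
Proof. by rewrite /bit (tnth_nth false) /= nth_nseq if_same. Qed.

(** The flip of [p] undoes itself and leaves the bits below [p - 1] alone, so these are [0] in [w']
    as well. This serves the second half of the code, which runs through the shorter code
    backwards. *)
Lemma gray_adjacent_sym n : symmetric (gray_adjacent n).
Proof.
suff sub w w' : gray_adjacent n w w' -> gray_adjacent n w' w.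
  by move=> w w'; apply/idP/idP; apply: sub.
case/existsP=> p /andP[/forallP flip /forallP low]; apply/existsP; exists p.
apply/andP; split; apply/forallP=> q; first by rewrite (eqP (flip q)) addbK.
apply/implyP=> lt_qp; rewrite (eqP (flip q)).
have /negPf-> : q != p by apply: contraTneq lt_qp => ->; rewrite ltnNge leqnSn.
by rewrite addbF (implyP (low q)).
Qed.

Lemma gray_adjacent_cons n b (w w' : word n) :
  gray_adjacent n w w' ->
  gray_adjacent n.+1 (cons_tuple b w) (cons_tuple b w').
Proof.
case/existsP=> p /andP[/forallP flip /forallP low].
apply/existsP; exists (widen_ord (leqnSn n) p).
apply/andP; split; apply/forallP=> q; case: (ord_split n q) => [->|[r ->]].
- rewrite !bit_cons_last; have /negPf-> : ord_max != widen_ord (leqnSn n) p.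
    by rewrite -val_eqE /= neq_ltn ltn_ord orbT.
  by rewrite addbF.
- by rewrite !bit_cons_lower -val_eqE /= val_eqE.
- by apply/implyP=> /= lt_np; have := ltn_ord p; rewrite ltnNge ltnW // ltnW.
- by rewrite bit_cons_lower; apply: low.
Qed.

Lemma head_gray n w0 : head w0 (gray n) = [tuple of nseq n false].
Proof.
elim: n w0 => [|n IHn] w0; first by apply: val_inj.
have: 0 < size (gray n) by rewrite size_gray expn_gt0.
rewrite /=; case: (gray n) IHn => //= w s IHn _.
by rewrite (IHn w); apply: val_inj.
Qed.

(** By the reversal, the last word is a [1] followed by the first word of the shorter code, hence
    [10...0]. *)
Lemma last_gray_low n w0 (q : 'I_n) :
  q.+1 < n -> bit (last w0 (gray n)) q = false.
Proof.
case: n w0 q => // n w0 q lt_qn.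
have gray_gt0 : 0 < size (gray n) by rewrite size_gray expn_gt0.
have [w def_last] : exists w, last w0 (gray n.+1) = cons_tuple true w
    /\ w = [tuple of nseq n false].
  exists (head [tuple of nseq n false] (gray n)); split; last exact: head_gray.
  rewrite /= last_cat; case: (gray n) gray_gt0 => //= v s _.
  by rewrite rev_cons map_rcons last_rcons.
case: def_last => -> ->; case: (ord_split n q) lt_qn => [->|[r ->] _].
  by rewrite ltnn.
by rewrite bit_cons_lower bit_nseq_false.
Qed.

(** Inside each half, adjacency is inherited from the shorter code. At the junction the same word
    [w] is prefixed by [0] and then by [1]: only position [n] flips, and [last_gray_low] gives the
    zeros below [n - 1]. *)
Lemma gray_sorted n : sorted (gray_adjacent n) (gray n).
Proof.
elim: n => //= n IHn.
have gray_gt0 : 0 < size (gray n) by rewrite size_gray expn_gt0.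
have low := last_gray_low n.
have cons_sorted b s : sorted (gray_adjacent n) s ->
    sorted (gray_adjacent n.+1) [seq cons_tuple b w | w <- s].
  by apply: homo_sorted => w w'; apply: gray_adjacent_cons.
have IHrev : sorted (gray_adjacent n) (rev (gray n)).
  rewrite rev_sorted; apply: sub_sorted IHn => w w'.
  by rewrite gray_adjacent_sym.
(* Peeling off the last word [w] shows it on both sides of the junction, since the reversed list
   begins with [w]. *)
case/lastP: (gray n) gray_gt0 low IHn IHrev => // s w _ low IHn IHrev.
rewrite rev_rcons map_rcons /= in IHrev *.
rewrite cat_rcons.
have := cons_sorted false _ IHn; rewrite map_rcons => IHl.
have IHr := cons_sorted true (w :: rev s) IHrev.
suff mid : gray_adjacent n.+1 (cons_tuple false w) (cons_tuple true w).
  case: (map _ s) IHl => [|x t] /=; first by rewrite mid.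
  by rewrite rcons_path cat_path /= mid => /andP[-> ->].
apply/existsP; exists ord_max.
apply/andP; split; apply/forallP=> q; case: (ord_split n q) => [->|[r ->]].
- by rewrite !bit_cons_last eqxx.
- rewrite !bit_cons_lower.
  have /negPf-> : widen_ord (leqnSn n) r != ord_max.
    by rewrite -val_eqE /= neq_ltn ltn_ord.
  by rewrite addbF.
- by rewrite ltnNge leqnSn.
- rewrite bit_cons_lower; apply/implyP=> lt_rn.
  by have := low w r lt_rn; rewrite last_rcons => ->.
Qed.

Lemma gray_word_adjacent n i :
  i.+1 < 2 ^ n -> gray_adjacent n (gray_word n i) (gray_word n i.+1).
Proof.
(* The default word is the one in [gray_word], so that the [nth] terms agree. *)
move=> lt_i; have /(sortedP [tuple of nseq n false]) := gray_sorted n.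
by apply; rewrite size_gray.
Qed.

(** The enumeration is increasing and the top is the end of the list; [rev] brings the smallest
    position there. *)
Definition parity_stack (n : nat) (b : bool) (w : word n) : seq 'I_n :=
  rev [seq p <- enum 'I_n | bit w p && (odd p == b)].

Lemma enum_ord_cat_lt n (s1 s2 : seq 'I_n) (p q : 'I_n) :
  enum 'I_n = s1 ++ p :: s2 -> q \in s1 -> q < p.
Proof.
move=> def_enum s1q; have := iota_ltn_sorted 0 n.
rewrite -val_enum_ord def_enum map_cat /= (sorted_pairwise ltn_trans).
by rewrite pairwise_cat => /andP[/allrelP lt_s _]; apply: lt_s;
  rewrite ?map_f ?mem_head.
Qed.

Lemma parity_stack_flip n (p : 'I_n) (w w' : word n) :
  flips_at n p w w' ->
  parity_stack n (~~ odd p) w' = parity_stack n (~~ odd p) w /\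
  stack_step (parity_stack n (odd p) w) (parity_stack n (odd p) w').
Proof.
case/andP=> /forallP flip /forallP low; split.
  congr rev; apply: eq_filter => q; rewrite (eqP (flip q)).
  by case: eqVneq => [->|_]; [case: (odd p); rewrite !andbF | rewrite addbF].
rewrite /parity_stack.
have p_in : p \in enum 'I_n by rewrite mem_enum.
(* The enumeration is cut at [p]. For the parity of [p], the part [s1] below contributes nothing
   before or after the flip, and [s2] contributes the same both times. *)
case def_enum: {1}_ / (splitPr p_in) => [s1 s2].
have uniq_s : uniq (s1 ++ p :: s2) by rewrite -def_enum enum_uniq.
have below v : v = w \/ v = w' ->
    [seq q <- s1 | bit v q && (odd q == odd p)] = [::].
  move=> v_eq; apply/eqP; rewrite -size_eq0 size_filter -leqn0 leqNgt -has_count.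
  apply/hasPn=> q s1q; have lt_qp := enum_ord_cat_lt n s1 s2 p q def_enum s1q.
  rewrite negb_and orbC; case: eqVneq => //= par.
  (* Equal parity excludes [q.+1 = p], the one lower position where a [1] is allowed. *)
  have lt_q1p : q.+1 < p.
    rewrite ltn_neqAle lt_qp andbT; apply: contra_eq_neq par => <- /=.
    by case: (odd q).
  have := implyP (low q) lt_q1p.
  case: v_eq => -> //; rewrite (eqP (flip q)).
  by rewrite -val_eqE (ltn_eqF lt_qp) addbF.
have above : [seq q <- s2 | bit w' q && (odd q == odd p)]
           = [seq q <- s2 | bit w q && (odd q == odd p)].
  apply: eq_in_filter => q s2q; rewrite (eqP (flip q)).
  case: eqVneq => [q_p|_]; last by rewrite addbF.
  by move: uniq_s; rewrite cat_uniq /= -q_p s2q !andbF.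
rewrite ?def_enum !filter_cat (below w (or_introl erefl)) (below w' (or_intror erefl)) /=.
rewrite above (eqP (flip p)) !eqxx !andbT addbT.
(* The filtered lists differ only by [p] in front, which [rev] turns into the top: a pop if the bit
   was [1], a push if it was [0]. *)
by case: (bit w p); [right | left]; exists p; rewrite rev_cons.
Qed.

Lemma mem_parity_stack n b (w : word n) p :
  (p \in parity_stack n b w) = bit w p && (odd p == b).
Proof. by rewrite mem_rev mem_filter mem_enum andbT. Qed.

Lemma parity_stack_uniq n b (w : word n) : uniq (parity_stack n b w).
Proof. by rewrite rev_uniq filter_uniq // enum_uniq. Qed.

Lemma parity_stack_represents n (w : word n) :
  represents (parity_stack n false w, parity_stack n true w) w.
Proof.
split=> [|p] /=; last first.
  by rewrite mem_cat !mem_parity_stack; case: (odd p); rewrite andbF andbT ?orbF.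
rewrite cat_uniq !parity_stack_uniq andbT.
apply/hasPn=> p; rewrite !mem_parity_stack => /andP[_ /eqP ->].
by rewrite andbF.
Qed.

Lemma parity_stack_step n (w w' : word n) :
  gray_adjacent n w w' ->
  pair_step (parity_stack n false w, parity_stack n true w)
            (parity_stack n false w', parity_stack n true w').
Proof.
case/existsP=> p /parity_stack_flip [].
(* The second stack moves when [p] is odd, the first when [p] is even. *)
by case: (odd p) => /= same step; [right | left].
Qed.

Theorem theorem4p1 (n : nat) (hn : 1 <= n) :
  exists st : nat -> seq 'I_n * seq 'I_n,
    (forall i : nat, i <= 2 ^ n - 1 -> represents (st i) (gray_word n i)) /\
    (forall i : nat, i < 2 ^ n - 1 -> pair_step (st i) (st i.+1)).
Proof.
exists (fun i => (parity_stack n false (gray_word n i),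
                  parity_stack n true (gray_word n i))).
split=> i lt_i; first exact: parity_stack_represents.
by apply: parity_stack_step; apply: gray_word_adjacent; rewrite -[i.+1]add1n -ltn_subRL.
Qed.
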